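(* Let $\mathcal{R} = \langle R, \lesssim\rangle$ be a rulebook on $\mathcal{T}\times\mathcal{E}$ in which every rule $r\in R$ is measurable and is equipped with a risk measure $\rho_r : \mathcal{F}(\Omega,\mathbb{R})\to\mathbb{R}$ and a threshold $\gamma_r\in\mathbb{R}$. Then the induced risk-aware rulebook $\mathcal{R}_{\text{risk}} = \langle R_{\text{risk}}, \lesssim_{\text{risk}}\rangle$ is a rulebook on $\mathcal{T}$.
   Context: A preorder on a set is a reflexive and transitive binary relation on it. A rule on a set $\Xi$ is a function $\Xi\to\mathbb{R}_{\ge 0}$. A rulebook on $\Xi$ is a tuple $\langle R,\lesssim\rangle$ where $R$ is a finite set of rules on $\Xi$ and $\lesssim$ is a preorder on $R$. Setting: $\mathcal{T}$ (system trajectories) and $\mathcal{E}$ (environment trajectories) are standard Borel spaces; $(\Omega,\Sigma,\mathit{Pr})$ is a probability space with $\Omega$ nonempty and $\Sigma$ a standard Borel $\sigma$-algebra; $\mathbf{E}:\mathcal{T}\times\Omega\to\mathcal{E}$ is a Borel function, and $\mathbf{E}_\tau(\omega)=\mathbf{E}(\tau,\omega)$ for $\tau\in\mathcal{T}$, $\omega\in\Omega$. $\mathcal{F}(\Omega,\mathbb{R})$ is the set of measurable functions $\Omega\to\mathbb{R}$. A risk measure is a map $\mathcal{F}(\Omega,\mathbb{R})\to\mathbb{R}$. For a measurable rule $r:\mathcal{T}\times\mathcal{E}\to\mathbb{R}_{\ge 0}$ with risk measure $\rho_r$ and threshold $\gamma_r$, and $\tau\in\mathcal{T}$, let $r_\tau:\Omega\to\mathbb{R}_{\ge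 0}$ be the (measurable) function $r_\tau(\omega)=r(\tau,\mathbf{E}_\tau(\omega))$. The risk-aware rule induced by $(r,\rho_r,\gamma_r)$ is the function $r_{\text{risk}}:\mathcal{T}\to\mathbb{R}_{\ge 0}$ defined by $r_{\text{risk}}(\tau)=\max\{\rho_r(r_\tau)-\gamma_r,0\}$. Different rules may have different risk measures and thresholds. The induced risk-aware rulebook on $\mathcal{T}$ is the tuple $\mathcal{R}_{\text{risk}}=\langle R_{\text{risk}},\lesssim_{\text{risk}}\rangle$, where $R_{\text{risk}}=\{r_{\text{risk}} \mid r\in R\}$ and $\lesssim_{\text{risk}}$ is defined by $r_{\text{risk}}\lesssim_{\text{risk}} r'_{\text{risk}}$ if and only if $r\lesssim r'$.
   Formalization: Distinct rules may induce the same risk-aware rule, leaving the induced preorder ill-defined; the claim is proved for any relation satisfying its defining equivalence, and unconditionally when each risk-aware rule is labelled by the rule it comes from. *)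

(* Defs.v *)
From HB Require Import structures.
From mathcomp Require Import all_boot all_order all_algebra.
From mathcomp Require Import all_classical all_reals all_analysis.
Set Implicit Arguments.
Unset Strict Implicit.
Unset Printing Implicit Defensive.
Import Order.TTheory GRing.Theory Num.Theory.
Import numFieldNormedType.Exports.
Local Open Scope classical_set_scope.
Local Open Scope ring_scope.

(* The sigma-algebra of T is the Borel sigma-algebra of a Polish space X,
   transported along a bijection. A Hausdorff pseudometric is a metric, so X
   ranges over the complete separable metric spaces. *)
Definition standard_borel (R : realType) (d : measure_display)
    (T : measurableType d) : Prop :=
  exists (X : completePseudoMetricType R) (f : T -> X),
    [/\ hausdorff_space X,
        exists2 D : set X, countable D & dense D,
        bijective f
      & forall B : set X, measurable (f @^-1` B) <-> <<s [set U : set X | open U] >> B].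

Definition is_rule (R : realType) (Xi : Type) (r : Xi -> R) : Prop :=
  forall x, 0 <= r x.

(* The bare tuple <R, <~>; only the restriction of [rule_le] to [rules] is
   meaningful. *)
Record rule_tuple (R : realType) (Xi : Type) := RuleTuple {
  rules : set (Xi -> R);
  rule_le : rel (Xi -> R)
}.

Definition is_preorder_on (X : Type) (A : set X) (le : rel X) : Prop :=
  {in A, reflexive le} /\ {in A & &, transitive le}.

Definition is_rulebook (R : realType) (Xi : Type) (B : rule_tuple R Xi) : Prop :=
  [/\ forall r, rules B r -> is_rule r,
      finite_set (rules B)
    & is_preorder_on (rules B) (rule_le B)].

(* A rulebook whose rules carry names from A: the rule named a is [rule a], and
   two names may denote the same function. Since r |-> r_risk need not be
   injective, this is what makes "r_risk <~ r'_risk iff r <~ r'" a definition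
   for every rulebook. *)
Definition is_named_rulebook (R : realType) (Xi X : Type) (A : set X)
    (rule : X -> Xi -> R) (le : rel X) : Prop :=
  [/\ forall a, A a -> is_rule (rule a),
      finite_set A
    & is_preorder_on A le].

Section risk.
Context {R : realType} {dT dE dO : measure_display}.
Context {T : measurableType dT} {E : measurableType dE} {Omega : measurableType dO}.

Definition risk_measure := {mfun Omega >-> R} -> R.

Section rule_at.
Variables (Env : {mfun (T * Omega)%type >-> E}) (r : {mfun (T * E)%type >-> R}).
Variable tau : T.

Definition rule_at (w : Omega) : R := r (tau, Env (tau, w)).

Lemma measurable_rule_at : measurable_fun [set: Omega] rule_at.
Proof.
apply: (@measurableT_comp _ _ _ _ _ _ r [set: Omega]
  (fun w => (tau, Env (tau, w)))) => //.
apply/measurable_fun_pairP; split; first exact: measurable_cst.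
by apply: (measurableT_comp (f := Env)) => //; exact: pair1_measurable.
Qed.

HB.instance Definition _ := isMeasurableFun.Build _ _ _ _ rule_at measurable_rule_at.
End rule_at.

Definition risk_rule (Env : {mfun (T * Omega)%type >-> E})
    (r : {mfun (T * E)%type >-> R}) (rho : risk_measure) (gamma : R) : T -> R :=
  fun tau => Num.max (rho (rule_at Env r tau) - gamma) 0.

(* [rule_le Brisk] has to satisfy the equivalence defining the induced preorder
   for all representatives r, r'; [induced_risk_rulebook_exists] tells when this
   is possible. *)
Definition is_induced_risk_rulebook (Env : {mfun (T * Omega)%type >-> E})
    (B : rule_tuple R (T * E)) (rho : (T * E -> R) -> risk_measure)
    (gamma : (T * E -> R) -> R) (Brisk : rule_tuple R T) : Prop :=
  rules Brisk =
    [set risk_rule Env r (rho r) (gamma r)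
      | r in [set r : {mfun (T * E)%type >-> R} | rules B r]]
  /\ forall r r' : {mfun (T * E)%type >-> R}, rules B r -> rules B r' ->
       rule_le Brisk (risk_rule Env r (rho r) (gamma r))
                     (risk_rule Env r' (rho r') (gamma r'))
       = rule_le B r r'.

Lemma induced_risk_rulebook_exists (Env : {mfun (T * Omega)%type >-> E})
    (B : rule_tuple R (T * E)) (rho : (T * E -> R) -> risk_measure)
    (gamma : (T * E -> R) -> R) :
  (exists Brisk, is_induced_risk_rulebook Env B rho gamma Brisk) <->
  (forall r1 r2 r1' r2' : {mfun (T * E)%type >-> R},
     rules B r1 -> rules B r2 -> rules B r1' -> rules B r2' ->
     risk_rule Env r1 (rho r1) (gamma r1) = risk_rule Env r2 (rho r2) (gamma r2) ->
     risk_rule Env r1' (rho r1') (gamma r1') = risk_rule Env r2' (rho r2') (gamma r2') ->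
     rule_le B r1 r1' = rule_le B r2 r2').
Proof.
split=> [[Q [_ leQ]] r1 r2 r1' r2' B1 B2 B1' B2' e e'|wd].
  by rewrite -!leQ// e e'.
pose le (f g : T -> R) := `[< exists r r' : {mfun (T * E)%type >-> R},
  [/\ rules B r, rules B r', f = risk_rule Env r (rho r) (gamma r),
      g = risk_rule Env r' (rho r') (gamma r') & rule_le B r r'] >].
exists (RuleTuple [set risk_rule Env r (rho r) (gamma r)
  | r in [set r : {mfun (T * E)%type >-> R} | rules B r]] le).
split=> // r r' Br Br'; apply/asboolP/idP => [|rr']; last by exists r, r'.
by move=> [s [s' [Bs Bs' e e' ss']]]; rewrite (wd r s r' s').
Qed.

End risk.
Arguments risk_measure R {dO} Omega.

(* Main.v *)
Require Import Defs.
From HB Require Import structures.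
From mathcomp Require Import all_boot all_order all_algebra.
From mathcomp Require Import all_classical all_reals all_analysis.
Set Implicit Arguments.
Unset Strict Implicit.
Unset Printing Implicit Defensive.
Import Order.TTheory GRing.Theory Num.Theory.
Import numFieldNormedType.Exports.
Local Open Scope classical_set_scope.
Local Open Scope ring_scope.

(** Each rulebook axiom passes from [B] to the induced tuple separately. Nonnegativity comes from
    the maximum with 0 in [risk_rule]. Finiteness holds because the measurable rules of [B] form a
    finite set, of which the induced rules are the image. Reflexivity and transitivity are pulled
    back to representatives in [B], where the two orders agree by definition. Under names no
    representative has to be chosen, and the order is that of [B] itself. *)

Lemma mfun_fun_inj d1 d2 (X : measurableType d1) (Y : measurableType d2) :
  injective (fun f : {mfun X >-> Y} => f : X -> Y).
Proof. by move=> f g fg; apply/mfuneqP => x; rewrite fg. Qed.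

Theorem proposition1 (R : realType) (dT dE dO : measure_display)
    (T : measurableType dT) (E : measurableType dE) (Omega : measurableType dO)
    (sbT : standard_borel R T) (sbE : standard_borel R E)
    (sbOmega : standard_borel R Omega)
    (Pr : probability Omega R)
    (Env : {mfun (T * Omega)%type >-> E})
    (B : rule_tuple R (T * E)) (rulebookB : is_rulebook B)
    (measB : forall r, rules B r -> measurable_fun [set: T * E] r)
    (rho : (T * E -> R) -> risk_measure R Omega)
    (gamma : (T * E -> R) -> R) :
  (forall Brisk : rule_tuple R T,
     is_induced_risk_rulebook Env B rho gamma Brisk -> is_rulebook Brisk)
  /\ is_named_rulebook [set r : {mfun (T * E)%type >-> R} | rules B r]
       (fun r => risk_rule Env r (rho r) (gamma r))
       (fun r r' => rule_le B r r').
Proof.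
case: rulebookB => _ finB [reflB transB].
have finM : finite_set [set r : {mfun (T * E)%type >-> R} | rules B r].
  (* Bundled measurable functions embed in plain functions, so finiteness of [rules B] pulls back
     along the coercion. *)
  by apply: finite_preimage finB => r s _ _; exact: mfun_fun_inj.
have risk_rule_ge0 (r : {mfun (T * E)%type >-> R}) :
  is_rule (risk_rule Env r (rho r) (gamma r)).
  by move=> tau; rewrite /risk_rule le_max lexx orbT.
split=> [Brisk [rulesE leE]|]; split=> //.
- by move=> f; rewrite rulesE => -[r _ <-].
- by rewrite rulesE; exact: finite_image.
- rewrite rulesE; split=> [f /set_mem[r Br <-]|].
    by rewrite leE//; apply/reflB/mem_set.
  (* [transitive] binds the middle element first, so [s] represents the middle rule. The same [s]
     serves in both comparisons because [leE] holds for every choice of representatives. *)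
  move=> g f h /set_mem[s Bs <-] /set_mem[r Br <-] /set_mem[t Bt <-].
  by rewrite !leE//; apply: transB; exact/mem_set.
- split=> [r /set_mem Br|s r t /set_mem Bs /set_mem Br /set_mem Bt].
    exact/reflB/mem_set.
  by apply: transB; exact/mem_set.
Qed.
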